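(* For each positive integer $n$, let $0<p_n,q_n\le 1$ and let $\lambda^{(0)}$ be a (possibly random) partition of $n$. Let $(\lambda^{(0)},\lambda^{(1)},\dotsc)$ be the Markov chain on the set $\mathcal{P}(n)$ of integer partitions of $n$ given by $p_n$-random $q_n$-proportion Bulgarian solitaire $\mathscr{B}(n,p_n,q_n)$, and let $\pi_{n,p_n,q_n}$ be its stationary measure. Suppose \[ p_nq_n\to 0\quad\text{and}\quad \frac{p_nq_n^2 n}{\log n}\to\infty\qquad(n\to\infty). \] Then $\pi_{n,p_n,q_n}$ has the limit shape $\phi(x)=e^{-x}$ under the scaling $a_n=(p_nq_n)^{-1}$, i.e. for every $x>0$ and every $\varepsilon>0$, \[ \lim_{n\to\infty}\pi_{n,p_n,q_n}\{\lambda\in\mathcal{P}(n): |\rho_{a_n}(\lambda)(x)-e^{-x}|<\varepsilon\}=1. \]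
   Context: $p$-random $q$-proportion Bulgarian solitaire $\mathscr{B}(n,p,q)$ ($0<p,q\le 1$) is played on $n$ identical cards distributed in piles; a configuration is the partition of $n$ given by the pile sizes. In one move, from each pile of size $h$ the top $\lceil qh\rceil$ cards are candidates; each candidate card is picked with probability $p$, independently of all other candidate cards; all picked cards are removed from their piles and together form one new pile (if no card is picked, no new pile arises). For $p<1$ this Markov chain on $\mathcal{P}(n)$ is irreducible and aperiodic, and $\pi_{n,p,q}$ denotes its unique stationary distribution. For a partition $\lambda=(\lambda_1\ge\lambda_2\ge\dotsb)$ of $n$ (with $\lambda_i=0$ beyond its number of parts) and scaling factor $a>0$, the rescaled diagram-boundary function is $\rho_a(\lambda)(x)=\frac{a}{n}\lambda_{\lfloor ax\rfloor+1}$ for $x\ge 0$. *)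

(* Defs.v *)
From mathcomp Require Import all_boot all_order all_algebra.
From mathcomp Require Import all_classical all_reals all_analysis.
Set Implicit Arguments. Unset Strict Implicit. Unset Printing Implicit Defensive.
Import Order.TTheory GRing.Theory Num.Theory.
Local Open Scope ring_scope.

(* A partition of n, represented by its first n parts lambda_1 >= ... >= lambda_n
   (a partition of n has at most n nonzero parts; the remaining ones are 0),
   each in {0,..,n}, summing to n.  Index i : 'I_n stands for lambda_{i+1}. *)
Definition is_partn (n : nat) (f : {ffun 'I_n -> 'I_n.+1}) : bool :=
  [forall i : 'I_n, forall j : 'I_n, (i <= j)%N ==> (f j <= f i)%N]
  && ((\sum_(i < n) (f i : nat))%N == n).

Definition npart (n : nat) := {f : {ffun 'I_n -> 'I_n.+1} | is_partn f}.

Definition part_at (n : nat) (la : npart n) (j : nat) : nat :=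
  match insub j : option 'I_n with
  | Some i => (val la i : nat)
  | None => 0%N
  end.

Definition to_conf (n : nat) (s : seq nat) : {ffun 'I_n -> 'I_n.+1} :=
  [ffun i : 'I_n => inord (nth 0%N (sort geq s) i)].

Section Bulgarian.
Variable R : realType.

Definition ncand (q : R) (h : nat) : nat := `|Num.ceil (q * h%:R)|%N.

(* Transition probability of p-random q-proportion Bulgarian solitaire
   from la to mu: from pile i (of size la_i) k_i of its ceil(q la_i) candidate
   cards are picked (independent Bernoulli(p) choices, so probability
   C(c_i,k_i) p^k_i (1-p)^(c_i-k_i)); the new configuration consists of the
   piles la_i - k_i together with a new pile of size sum_i k_i (empty piles
   are discarded, i.e. are the zero parts). *)
Definition bs_trans (n : nat) (p q : R) (la mu : npart n) : R :=
  \sum_(k : {ffun 'I_n -> 'I_n.+1}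
         | [forall i, (k i <= ncand q (val la i))%N])
    (\prod_(i < n)
        (('C(ncand q (val la i), k i))%:R * p ^+ (k i)
          * (1 - p) ^+ (ncand q (val la i) - k i)))
    * (to_conf n ([seq ((val la i : nat) - k i)%N | i <- enum 'I_n]
                    ++ [:: (\sum_(i < n) (k i : nat))%N]) == val mu)%:R.

Definition bs_stationary (n : nat) (p q : R) (pi : {ffun npart n -> R}) : Prop :=
  (forall la, 0 <= pi la) /\ \sum_la pi la = 1 /\
  (forall mu, \sum_la pi la * bs_trans p q la mu = pi mu).

Definition rho (n : nat) (a : R) (la : npart n) (x : R) : R :=
  a / n%:R * (part_at la (Num.truncn (a * x)))%:R.

End Bulgarian.

(* Main.v *)
(* Write s = p q, W = s n, and compare the sorted piles with the geometric
   profile c_i = W (1-s)^i, which a noiseless move reproduces exactly (each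
   pile shrinks by the factor 1-s, the new pile has size c_0).  The distance is
   G = sum_i psi(lambda_i - c_i) with psi(u) = sqrt(u^2 + W^2) - W.  As psi is
   convex, re-sorting the piles after a move can only decrease G.  As psi is
   1-Lipschitz with second derivative at most 1/W, the binomial noise
   contributes only variance / W and the rounding in ceil(q h) only p per pile,
   so E G' <= (1-s) G + 3 p M + 1, where M is the number of piles; for a
   stationary law this gives s E G <= 3 p E M + 1.  Applying stationarity to
   sum_i ln(1 + lambda_i), which loses at least s/2 per pile in one move and
   gains at most ln(1 + n), yields s E M <= 2 ln(1 + n); this is where the
   hypothesis on p q^2 n / ln n enters: it gives E G = o(n).  Since both
   profiles are nonincreasing, a deviation of order W at one index persists
   over an order of 1/s indices and forces G to be of order n, so Markov's
   inequality concludes. *)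
Require Import Defs.
From mathcomp Require Import all_boot all_order all_algebra.
From mathcomp Require Import all_classical all_reals all_analysis.
From mathcomp Require Import ring lra zify.
Set Implicit Arguments. Unset Strict Implicit. Unset Printing Implicit Defensive.
Import Order.TTheory GRing.Theory Num.Theory.
Local Open Scope classical_set_scope.
Local Open Scope ring_scope.

(** * Sorting and exchange inequalities *)

Section Insertion.
Variable R : realType.

Fixpoint insert (x : nat) (s : seq nat) : seq nat :=
  if s is y :: s' then if (y <= x)%N then x :: s else y :: insert x s'
  else [:: x].

Lemma perm_insert x s : perm_eq (insert x s) (x :: s).
Proof.
elim: s => //= y s IH; case: ifP => // _.
rewrite -(perm_cons y) in IH; apply: (perm_trans IH).
by rewrite -[[:: y, x & s]]/([:: y] ++ [:: x] ++ s) perm_catCA.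
Qed.

Lemma sorted_insert x s : sorted geq s -> sorted geq (insert x s).
Proof.
have geq_trans : transitive geq by move=> a b c /= ab bc; exact: leq_trans bc ab.
elim: s => //= y s IH ys; case: ifP => [yx|/negbT].
  by rewrite /= yx.
rewrite -ltnNge => xy; move: ys; rewrite /= !path_sortedE// => /andP[sy ss].
rewrite IH// andbT; rewrite (perm_all _ (perm_insert x s)) /= sy andbT.
exact: ltnW.
Qed.

(** A sorted permutation is unique, so the library's sort agrees with insertion sort, along which
    rearrangement inequalities follow by induction. *)
Lemma sort_geq_insert s : sort geq s = foldr insert [::] s.
Proof.
have geq_trans : transitive geq by move=> a b c /= ab bc; exact: leq_trans bc ab.
have geq_anti : antisymmetric geq.
  by move=> a b /=; rewrite andbC => /anti_leq.
have geq_total : total geq by move=> a b; exact: leq_total.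
apply: (sorted_eq geq_trans geq_anti).
- exact: sort_sorted.
- by elim: s => //= x s; exact: sorted_insert.
- rewrite perm_sort; elim: s => //= x s IH.
  rewrite perm_sym (perm_trans (perm_insert _ _))// perm_cons perm_sym//.
Qed.

(** Shifting the weights along the recursion matches the recursion of [insert] and avoids index
    arithmetic. *)
Fixpoint wsum (f : nat -> nat -> R) (l : seq nat) : R :=
  if l is x :: l' then f 0%N x + wsum (fun i => f i.+1) l' else 0.

Lemma wsumE f l : wsum f l = \sum_(i < size l) f i (nth 0%N l i).
Proof.
elim: l f => [|x l IH] f /=; first by rewrite big_ord0.
by rewrite big_ord_recl IH.
Qed.

(** Insertion is a chain of adjacent swaps, each moving a larger entry in front of [x]; the
    hypothesis says that no such swap increases the sum. *)
Lemma wsum_insert f x s :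
  (forall i x y, (x <= y)%N -> f i y + f i.+1 x <= f i x + f i.+1 y) ->
  wsum f (insert x s) <= wsum f (x :: s).
Proof.
elim: s f => [|y s IH] f hf //=; case: ifP => // /negbT; rewrite -ltnNge => xy.
have := IH (fun i => f i.+1) (fun i => hf i.+1).
have := hf 0%N _ _ (ltnW xy).
rewrite /=; lra.
Qed.

Lemma wsum_sort f l :
  (forall i x y, (x <= y)%N -> f i y + f i.+1 x <= f i x + f i.+1 y) ->
  wsum f (sort geq l) <= wsum f l.
Proof.
rewrite sort_geq_insert; elim: l f => //= x l IH f hf.
apply: le_trans (wsum_insert _ _ hf) _ => /=.
by rewrite lerD2l IH// => i; exact: hf.
Qed.

End Insertion.

(** Before sorting, the new pile is placed in front and every old pile moves up one index, as in a
    noiseless move of the geometric profile. Sorting then only lowers the sum. *)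
Lemma wsum_conf (R : realType) n (f : nat -> nat -> R) (la k : 'I_n -> nat) :
  (forall i h, 0 <= f i h) ->
  (forall i x y, (x <= y)%N -> f i y + f i.+1 x <= f i x + f i.+1 y) ->
  (\sum_(i < n) la i = n)%N -> (forall i, k i <= la i)%N ->
  \sum_(i < n) f i (to_conf n ([seq (la i - k i)%N | i <- enum 'I_n]
                               ++ [:: (\sum_(i < n) k i)%N]) i) <=
    f 0%N (\sum_(i < n) k i)%N + \sum_(i < n) f i.+1 (la i - k i)%N.
Proof.
move=> f0 hf sla kla; set s := _ ++ _.
have las i : (la i <= n)%N by rewrite -[X in (_ <= X)%N]sla (bigD1 i)//= leq_addr.
have sn : all (fun x => x <= n)%N s.
  rewrite all_cat all_map /= andbT; apply/andP; split.
    by apply/allP => i _ /=; rewrite (leq_trans (leq_subr _ _)).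
  by rewrite -[X in (_ <= X)%N]sla; apply: leq_sum.
(* The [inord] in [to_conf] preserves an entry only if it is at most n. *)
have ns i : (nth 0 (sort geq s) i < n.+1)%N.
  have [ls|ls] := ltnP i (size s); last by rewrite nth_default// size_sort.
  rewrite ltnS; move/allP: sn; apply.
  by rewrite -(mem_sort geq) mem_nth// size_sort.
set t := (\sum_(i < n) k i)%N :: [seq (la i - k i)%N | i <- enum 'I_n].
have st : sort geq s = sort geq t.
  apply/perm_sortP.
  - by move=> a b; exact: leq_total.
  - by move=> a b c /= ab bc; exact: leq_trans bc ab.
  - by move=> a b /=; rewrite andbC => /anti_leq.
  - by rewrite perm_catC.
have sizet : size t = n.+1 by rewrite /= size_map size_enum_ord.
(* There are n+1 piles but [to_conf] keeps n entries; the dropped term is nonnegative. *)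
apply: (@le_trans _ _ (wsum f (sort geq t))).
  rewrite wsumE size_sort sizet big_ord_recr /= -st.
  rewrite -[leLHS]addr0 lerD//; apply: ler_sum => i _.
  by rewrite /to_conf ffunE inordK.
apply: le_trans (wsum_sort _ hf) _.
rewrite /t /= lerD2l wsumE size_map size_enum_ord.
apply: ler_sum => i _.
by rewrite (nth_map i) ?size_enum_ord// nth_ord_enum.
Qed.

(** * Independent binomial picks *)

Section ProductMeasure.
Variables (R : realType) (I K : finType) (w : I -> K -> R).
Hypothesis w1 : forall i, \sum_k w i k = 1.

(** Expectation of [F] when the coordinates of [k] are independent, coordinate i having law
    [w i]. *)
Definition prodE (F : {ffun I -> K} -> R) : R :=
  \sum_(k : {ffun I -> K}) (\prod_i w i (k i)) * F k.

Lemma prodE_prod (f : I -> K -> R) :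
  prodE (fun k => \prod_i f i (k i)) = \prod_i \sum_k w i k * f i k.
Proof.
by rewrite bigA_distr_bigA /=; apply: eq_bigr => k _; rewrite big_split.
Qed.

Lemma prodE_coord i (f : K -> R) :
  prodE (fun k => f (k i)) = \sum_k w i k * f k.
Proof.
have := prodE_prod (fun j k => if j == i then f k else 1).
rewrite [RHS](bigD1 i)//= eqxx [X in _ * X]big1 ?mulr1; last first.
  move=> j /negPf ->; rewrite -[RHS](w1 j).
  by apply: eq_bigr => k _; rewrite mulr1.
move=> <-; apply: eq_bigr => k _; congr (_ * _).
by rewrite (bigD1 i)//= eqxx big1 ?mulr1// => j /negPf ->.
Qed.

Lemma prodE_coord2 i j (f g : K -> R) : i != j ->
  prodE (fun k => f (k i) * g (k j)) =
  (\sum_k w i k * f k) * (\sum_k w j k * g k).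
Proof.
move=> ij; have ji : (j == i) = false by rewrite eq_sym (negPf ij).
have := prodE_prod (fun l k => if l == i then f k else if l == j then g k else 1).
rewrite [RHS](bigD1 i)//= eqxx [X in _ * X](bigD1 j) ?ji//= eqxx.
rewrite [X in _ * (_ * X)]big1 ?mulr1; last first.
  move=> l /andP[/negPf -> /negPf ->]; rewrite -[RHS](w1 l).
  by apply: eq_bigr => k _; rewrite mulr1.
move=> <-; apply: eq_bigr => k _; congr (_ * _).
rewrite (bigD1 i)//= eqxx (bigD1 j) ?ji//= eqxx big1 ?mulr1//.
by move=> l /andP[/negPf -> /negPf ->].
Qed.

Lemma prodED F G : prodE (fun k => F k + G k) = prodE F + prodE G.
Proof.
by rewrite /prodE -big_split; apply: eq_bigr => k _; rewrite mulrDr.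
Qed.

Lemma prodEZ a F : prodE (fun k => a * F k) = a * prodE F.
Proof.
by rewrite /prodE big_distrr; apply: eq_bigr => k _ /=; rewrite mulrCA.
Qed.

Lemma prodE_sum (J : finType) (F : J -> {ffun I -> K} -> R) :
  prodE (fun k => \sum_j F j k) = \sum_j prodE (F j).
Proof.
rewrite /prodE exchange_big; apply: eq_bigr => k _.
by rewrite big_distrr.
Qed.

Lemma prodE_cst a : prodE (fun=> a) = a.
Proof.
have := prodE_prod (fun _ _ => 1).
rewrite [RHS]big1 => [h|i _]; last first.
  by rewrite -[RHS](w1 i); apply: eq_bigr => k _; rewrite mulr1.
rewrite -[RHS]mulr1 -h -prodEZ; apply: eq_bigr => k _.
by rewrite [X in a * X]big1// mulr1.
Qed.

Lemma ler_prodE (P : pred {ffun I -> K}) F G : (forall i k, 0 <= w i k) ->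
  (forall k, ~~ P k -> \prod_i w i (k i) = 0) ->
  (forall k, P k -> F k <= G k) -> prodE F <= prodE G.
Proof.
move=> w0 Pw FG; apply: ler_sum => k _; have [Pk|/Pw ->] := boolP (P k).
  by rewrite ler_wpM2l ?FG// prodr_ge0.
by rewrite !mul0r.
Qed.

(** Independence and centering kill the cross terms of the expanded square. *)
Lemma prodE_variance (X : I -> K -> R) :
  (forall i, \sum_k w i k * X i k = 0) ->
  prodE (fun k => (\sum_i X i (k i)) ^+ 2) = \sum_i \sum_k w i k * X i k ^+ 2.
Proof.
move=> X0; transitivity
    (\sum_i \sum_j prodE (fun k => X i (k i) * X j (k j))).
  under [RHS]eq_bigr do rewrite -prodE_sum.
  rewrite -prodE_sum; apply: eq_bigr => k _; congr (_ * _).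
  by rewrite expr2 big_distrl; apply: eq_bigr => i _; rewrite big_distrr.
apply: eq_bigr => i _; rewrite (bigD1 i)//= big1 ?addr0 => [|j ji].
  exact: (prodE_coord i (fun k => X i k * X i k)).
by rewrite prodE_coord2 1?eq_sym// X0 mul0r.
Qed.
End ProductMeasure.

(** * Moments of the binomial law *)

Section Binomial.
Variables (R : realType) (p : R).

Definition binw (c k : nat) : R := 'C(c, k)%:R * p ^+ k * (1 - p) ^+ (c - k).

(** Conditioning on a single trial: a failure leaves k unchanged, a success raises it by one.
    Termwise this is Pascal's rule. *)
Lemma sum_binwS c (f : nat -> R) :
  \sum_(k < c.+2) binw c.+1 k * f k =
  (1 - p) * (\sum_(k < c.+1) binw c k * f k)
  + p * (\sum_(k < c.+1) binw c k * f k.+1).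
Proof.
rewrite big_ord_recl /=.
have -> : \sum_(i < c.+1) binw c.+1 (bump 0 i) * f (bump 0 i) =
   \sum_(i < c.+1) (1 - p) * (binw c i.+1 * f i.+1)
   + \sum_(i < c.+1) p * (binw c i * f i.+1).
  rewrite -big_split; apply: eq_bigr => i _ /=; rewrite /binw /bump /= add1n.
  rewrite binS natrD subSS exprS.
  (* At i = c the truncated exponent c - (i+1) is wrong, but its binomial coefficient vanishes. *)
  have [ic|ci] := ltnP i c.
    by rewrite -(subnSK ic) exprS; ring.
  by rewrite bin_small//; ring.
rewrite -!big_distrr /= [in RHS]big_ord_recl big_ord_recr /=.
rewrite [in binw c c.+1]/binw bin_small// /binw !bin0 !subn0 exprS /bump /=.
under [in RHS]eq_bigr do rewrite add1n.
ring.
Qed.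

(** Picks range over the common type ['I_n.+1], whatever the number c of candidates; the extra terms
    have coefficient 0. *)
Lemma sum_binw_widen c n (f : nat -> R) : (c <= n)%N ->
  \sum_(k < n.+1) binw c k * f k = \sum_(k < c.+1) binw c k * f k.
Proof.
move=> cn; rewrite (@big_ord_widen _ _ _ c.+1 n.+1 (fun k => binw c k * f k))//.
rewrite [RHS]big_mkcond; apply: eq_bigr => k _; rewrite ltnS; case: leqP => // ck.
by rewrite /binw bin_small// !mul0r.
Qed.

Lemma sum_binw c n : (c <= n)%N -> \sum_(k < n.+1) binw c k = 1.
Proof.
move=> cn; under eq_bigr do rewrite -[binw _ _]mulr1.
rewrite (@sum_binw_widen _ _ (fun=> 1))//.
elim: c {cn} => [|c IH].
  by rewrite big_ord1 /binw bin0 !expr0 !mulr1.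
by rewrite (@sum_binwS _ (fun=> 1)) IH; ring.
Qed.

Lemma sum_binw_mean c n : (c <= n)%N ->
  \sum_(k < n.+1) binw c k * k%:R = p * c%:R.
Proof.
move=> cn; rewrite (@sum_binw_widen _ _ (fun k => k%:R))//.
elim: c {cn} => [|c IH]; first by rewrite big_ord1 mulr0 mulr0.
rewrite (@sum_binwS _ (fun k => k%:R)) IH.
under eq_bigr do rewrite -natr1 mulrDr mulr1.
by rewrite big_split /= IH sum_binw// -natr1; ring.
Qed.

Lemma sum_binw_variance c n : (c <= n)%N ->
  \sum_(k < n.+1) binw c k * (p * c%:R - k%:R) ^+ 2 = p * (1 - p) * c%:R.
Proof.
move=> cn; have -> : \sum_(k < n.+1) binw c k * (p * c%:R - k%:R) ^+ 2 =
    \sum_(k < n.+1) binw c k * k%:R ^+ 2 - (p * c%:R) ^+ 2.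
  transitivity (\sum_(k < n.+1) (binw c k * k%:R ^+ 2
       + ((- (2 * (p * c%:R))) * (binw c k * k%:R) + (p * c%:R) ^+ 2 * binw c k))).
    by apply: eq_bigr => k _; ring.
  by rewrite !big_split /= -!big_distrr /= sum_binw// sum_binw_mean//; ring.
rewrite (@sum_binw_widen _ _ (fun k => k%:R ^+ 2))//.
suff -> : \sum_(k < c.+1) binw c k * k%:R ^+ 2 =
  p * (1 - p) * c%:R + (p * c%:R) ^+ 2 by ring.
elim: c {cn} => [|c IH]; first by rewrite big_ord1 /=; ring.
rewrite (@sum_binwS _ (fun k => k%:R ^+ 2)) IH.
have -> : \sum_(k < c.+1) binw c k * k.+1%:R ^+ 2 =
  \sum_(k < c.+1) binw c k * k%:R ^+ 2 + 2 * (p * c%:R) + 1.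
  transitivity (\sum_(k < c.+1) (binw c k * k%:R ^+ 2
      + (2 * (binw c k * k%:R) + binw c k))).
    by apply: eq_bigr => k _; rewrite -natr1; ring.
  by rewrite !big_split /= -big_distrr /= sum_binw_mean// sum_binw// addrA.
by rewrite IH -natr1; ring.
Qed.

End Binomial.

(** * A smoothed absolute value *)

Section SoftAbs.
Variables (R : realType) (W : R).
Hypothesis W0 : 0 < W.

(** The Euclidean norm of the vector (u, W). Then [soft] is the function psi: roughly quadratic for
    u small against W, close to the absolute value for u large. *)
Definition hyp (u : R) : R := Num.sqrt (u ^+ 2 + W ^+ 2).
Definition soft (u : R) : R := hyp u - W.

Lemma hyp_sqr u : hyp u ^+ 2 = u ^+ 2 + W ^+ 2.
Proof. by rewrite sqr_sqrtr// addr_ge0 ?sqr_ge0. Qed.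

Lemma hyp_ge0 u : 0 <= hyp u. Proof. exact: sqrtr_ge0. Qed.

Lemma sqr_le_le (x y : R) : 0 <= y -> x ^+ 2 <= y ^+ 2 -> x <= y.
Proof. by move=> y0 xy; rewrite leNgt; apply/negP => yx; nra. Qed.

Lemma hyp_geW u : W <= hyp u.
Proof.
by apply: sqr_le_le; rewrite ?hyp_ge0// hyp_sqr lerDr sqr_ge0.
Qed.

Lemma hyp_gt0 u : 0 < hyp u.
Proof. exact: lt_le_trans W0 (hyp_geW u). Qed.

Lemma hyp_ge_norm u : `|u| <= hyp u.
Proof.
by apply: sqr_le_le; rewrite ?hyp_ge0// hyp_sqr real_normK ?num_real// lerDl sqr_ge0.
Qed.

Lemma soft_ge0 u : 0 <= soft u.
Proof. by rewrite subr_ge0 hyp_geW. Qed.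

Lemma hyp_cauchy_schwarz a d : a * d + W ^+ 2 <= hyp a * hyp d.
Proof.
apply: sqr_le_le; first by rewrite mulr_ge0 ?hyp_ge0.
rewrite exprMn !hyp_sqr; have := sqr_ge0 (W * (a - d)); nra.
Qed.

(** Triangle inequality for (d-b)(a,W) + (b-a)(d,W) = (d-a)(b,W); squaring reduces it to
    Cauchy-Schwarz. *)
Lemma hyp_convex a b d : a <= b -> b <= d ->
  (d - a) * hyp b <= (d - b) * hyp a + (b - a) * hyp d.
Proof.
move=> ab bd; have db0 : 0 <= d - b by rewrite subr_ge0.
have ba0 : 0 <= b - a by rewrite subr_ge0.
apply: sqr_le_le; first by rewrite addr_ge0 ?mulr_ge0 ?hyp_ge0.
have cs : 0 <= hyp a * hyp d - (a * d + W ^+ 2).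
  by rewrite subr_ge0 hyp_cauchy_schwarz.
rewrite -subr_ge0 [leRHS](_ : _ =
  2 * ((d - b) * (b - a) * (hyp a * hyp d - (a * d + W ^+ 2)))
  + (d - b) ^+ 2 * (hyp a ^+ 2 - (a ^+ 2 + W ^+ 2))
  + (b - a) ^+ 2 * (hyp d ^+ 2 - (d ^+ 2 + W ^+ 2))
  - (d - a) ^+ 2 * (hyp b ^+ 2 - (b ^+ 2 + W ^+ 2))); last by ring.
by rewrite !hyp_sqr !subrr !mulr0 subr0 !addr0 !mulr_ge0.
Qed.

(** The four arguments form two pairs of equal sum, and x - c and y - d are the extreme ones; a
    convex function has the smaller sum on the inner pair. *)
Lemma soft_exchange x y c d : x <= y -> d <= c ->
  soft (y - c) + soft (x - d) <= soft (x - c) + soft (y - d).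
Proof.
move=> xy dc; have [E|E] := eqVneq (x - c) (y - d).
  have -> : y = x by lra.
  by have -> : d = c by lra.
have h1 := @hyp_convex (x - c) (y - c) (y - d).
have h2 := @hyp_convex (x - c) (x - d) (y - d).
have {}h1 := h1 ltac:(lra) ltac:(lra); have {}h2 := h2 ltac:(lra) ltac:(lra).
have ad : 0 < y - d - (x - c) by rewrite lt_def; apply/andP; split; [rewrite subr_eq0 eq_sym|lra].
rewrite /soft; suff : hyp (y - c) + hyp (x - d) <= hyp (x - c) + hyp (y - d) by lra.
by rewrite -(ler_pM2l ad); lra.
Qed.

(** A global bound by a parabola tangent at u. After multiplication by [hyp u] it is AM-GM for
    [hyp u] and [hyp (u + v)]; the curvature 1 / [hyp u] is at most 1 / W. *)
Lemma soft_taylor u v :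
  soft (u + v) <= soft u + u / hyp u * v + (2 * W)^-1 * v ^+ 2.
Proof.
have u0 := hyp_gt0 u; have uW := hyp_geW u.
suff : hyp (u + v) <= hyp u + u / hyp u * v + (2 * hyp u)^-1 * v ^+ 2.
  have : (2 * hyp u)^-1 * v ^+ 2 <= (2 * W)^-1 * v ^+ 2.
    by rewrite ler_wpM2r ?sqr_ge0// lef_pV2 ?posrE ?ler_pM2l// ?mulr_gt0.
  rewrite /soft; lra.
rewrite -(ler_pM2l u0).
rewrite [leRHS](_ : _ = hyp u ^+ 2 + u * v + v ^+ 2 / 2); last by field; exact: lt0r_neq0.
have uv := hyp_sqr (u + v); have uu := hyp_sqr u.
have := sqr_ge0 (hyp u - hyp (u + v)); nra.
Qed.

Lemma soft_lip u b : soft (u + b) <= soft u + `|b|.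
Proof.
rewrite /soft addrAC lerD2r.
apply: sqr_le_le; first by rewrite addr_ge0 ?hyp_ge0.
have ub : u * b <= hyp u * `|b|.
  by rewrite (le_trans (ler_norm _))// normrM ler_wpM2r// hyp_ge_norm.
have := hyp_sqr (u + b); have := hyp_sqr u.
have := real_normK (num_real b); nra.
Qed.

Lemma soft0 : soft 0 = 0.
Proof. by rewrite /soft /hyp expr0n add0r sqrtr_sqr gtr0_norm ?subrr. Qed.

(** Convexity between 0 and u, where psi vanishes at 0; after squaring, only W <= [hyp u] is
    left. *)
Lemma soft_contract s u : 0 <= s -> s <= 1 ->
  soft ((1 - s) * u) <= (1 - s) * soft u.
Proof.
move=> s0 s1; rewrite /soft; suff : hyp ((1 - s) * u) <= (1 - s) * hyp u + s * W by lra.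
have uW := hyp_geW u.
apply: sqr_le_le; first by rewrite addr_ge0 ?mulr_ge0 ?hyp_ge0 ?subr_ge0// ltW.
rewrite -subr_ge0 [leRHS](_ : _ = 2 * (s * (1 - s) * (W * (hyp u - W)))
  + (1 - s) ^+ 2 * (hyp u ^+ 2 - (u ^+ 2 + W ^+ 2))
  - (hyp ((1 - s) * u) ^+ 2 - (((1 - s) * u) ^+ 2 + W ^+ 2))); last by ring.
rewrite !hyp_sqr !subrr mulr0 subr0 addr0.
by rewrite !mulr_ge0 ?subr_ge0// ltW.
Qed.

Lemma soft_mono u v : 0 <= v -> v <= `|u| -> soft v <= soft u.
Proof.
move=> v0 vu; rewrite lerD2r ler_wsqrtr// lerD2r -[leRHS]real_normK ?num_real//.
by rewrite lerXn2r.
Qed.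

Lemma soft_scale k : soft (k * W) = (Num.sqrt (k ^+ 2 + 1) - 1) * W.
Proof.
rewrite /soft mulrBl mul1r /hyp.
have -> : (k * W) ^+ 2 + W ^+ 2 = (k ^+ 2 + 1) * W ^+ 2 by ring.
by rewrite sqrtrM ?addr_ge0 ?sqr_ge0// sqrtr_sqr ger0_norm ?ltW.
Qed.

End SoftAbs.

(** * One move of the solitaire *)

Section Dynamics.
Variable R : realType.
Implicit Types (p q : R).

Lemma ncandE q h : 0 <= q -> (ncand q h)%:R = (Num.ceil (q * h%:R))%:~R :> R.
Proof.
move=> q0; rewrite /ncand pmulrn gez0_abs// -(ler_int R).
by apply: le_trans (ceil_ge _); rewrite mulr_ge0.
Qed.

Lemma ncand_ge q h : 0 <= q -> q * h%:R <= (ncand q h)%:R.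
Proof. by move=> q0; rewrite ncandE// ceil_ge. Qed.

(** An empty pile has no rounding error, so the total error is counted by the number of piles
    instead of n. *)
Lemma ncand_le q h : 0 <= q -> (ncand q h)%:R <= q * h%:R + (0 < h)%N%:R.
Proof.
move=> q0; rewrite ncandE//; case: h => [|h]; first by rewrite mulr0 ceil0 addr0.
by have := ceilB1_lt (q * h.+1%:R); rewrite intrB ltrBlDr => /ltW.
Qed.

Lemma ncand_leq q h : 0 <= q -> q <= 1 -> (ncand q h <= h)%N.
Proof.
move=> q0 q1; rewrite -(ler_nat R) ncandE// [leRHS]pmulrn ler_int ceil_le_int -pmulrn.
by rewrite ler_piMl.
Qed.

Lemma binw_ge0 p c k : 0 <= p -> p <= 1 -> 0 <= binw p c k.
Proof. by move=> p0 p1; rewrite !mulr_ge0 ?exprn_ge0 ?subr_ge0. Qed.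

Variables (n : nat) (p q : R).
Hypotheses (p0 : 0 <= p) (p1 : p <= 1) (q0 : 0 <= q) (q1 : q <= 1).
Implicit Type la : npart n.

Lemma npart_sum la : (\sum_(i < n) (val la i : nat) = n)%N.
Proof. by case: la => f /= /andP[_ /eqP]. Qed.

Lemma npart_le la (i : 'I_n) : (val la i <= n)%N.
Proof. by rewrite -ltnS ltn_ord. Qed.

Lemma npart_noninc la (i j : 'I_n) : (i <= j)%N -> (val la j <= val la i)%N.
Proof. by case: la => f /= /andP[/forallP/(_ i)/forallP/(_ j)/implyP h _]. Qed.

Definition pickw la (i : 'I_n) (k : 'I_n.+1) : R := binw p (ncand q (val la i)) k.
Definition pickE la (F : {ffun 'I_n -> 'I_n.+1} -> R) := prodE (pickw la) F.
Definition npiles la : R := \sum_(i < n) (0 < val la i)%N%:R.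

Lemma ncand_npart la i : (ncand q (val la i) <= n)%N.
Proof. exact: leq_trans (ncand_leq _ q0 q1) (npart_le _ _). Qed.

Lemma pickw1 la i : \sum_k pickw la i k = 1.
Proof. exact: (sum_binw p (ncand_npart la i)). Qed.

Lemma pickw_ge0 la i k : 0 <= pickw la i k.
Proof. exact: binw_ge0. Qed.

(** Picks beyond the candidates have weight zero, so the truncated subtraction from a pile is always
    a true one. *)
Lemma le_pickE la (F G : {ffun 'I_n -> 'I_n.+1} -> R) :
  (forall k : {ffun 'I_n -> 'I_n.+1}, (forall i, (k i <= val la i)%N) -> F k <= G k) ->
  pickE la F <= pickE la G.
Proof.
pose P (k : {ffun 'I_n -> 'I_n.+1}) :=
  [forall i, (k i <= ncand q (val la i))%N].
move=> FG; apply: (@ler_prodE _ _ _ _ P).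
- exact: pickw_ge0.
- move=> k /forallPn[i]; rewrite -ltnNge => ki.
  by rewrite (bigD1 i)//= {1}/pickw /binw bin_small// !mul0r.
- move=> k /forallP kc; apply: FG => i.
  exact: leq_trans (kc i) (ncand_leq _ q0 q1).
Qed.

(* Since F >= 0, an upper bound holds without knowing that the sorted list of
   new piles is a partition (otherwise the left-hand side loses mass). *)
Lemma trans_le la (F : {ffun 'I_n -> 'I_n.+1} -> R) : (forall f, 0 <= F f) ->
  \sum_mu bs_trans p q la mu * F (val mu) <=
  pickE la (fun k => F (to_conf n
      ([seq ((val la i : nat) - k i)%N | i <- enum 'I_n]
         ++ [:: (\sum_(i < n) (k i : nat))%N]))).
Proof.
move=> F0; under eq_bigr do rewrite /bs_trans mulr_suml.
rewrite exchange_big /= big_mkcond; apply: ler_sum => k _.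
have w0 : 0 <= \prod_i pickw la i (k i) by apply: prodr_ge0 => i _; exact: pickw_ge0.
case: ifP => _; last by rewrite mulr_ge0.
under eq_bigr do rewrite -mulrA.
rewrite -mulr_sumr ler_wpM2l//; set t := to_conf _ _.
have [tp|tp] := boolP (is_partn t).
  rewrite (bigD1 (exist _ t tp))//= eqxx mul1r big1 ?addr0// => mu.
  by rewrite -val_eqE eq_sym => /negPf /= ->; rewrite mul0r.
rewrite big1// => mu _; case: eqP => [E|]; last by rewrite mul0r.
by move: tp; rewrite E (valP mu).
Qed.

(** Stationarity inserts one move under the expectation, after which sorting is undone at the price
    of an inequality. *)
Lemma stationary_le (pi : {ffun npart n -> R}) (f : nat -> nat -> R) :
  bs_stationary p q pi ->
  (forall i h, 0 <= f i h) ->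
  (forall i x y, (x <= y)%N -> f i y + f i.+1 x <= f i x + f i.+1 y) ->
  \sum_la pi la * (\sum_(i < n) f i (val la i)) <=
  \sum_la pi la * pickE la (fun k => f 0%N (\sum_(i < n) k i)%N
                        + \sum_(i < n) f i.+1 (val la i - k i)%N).
Proof.
move=> [pi0 [_ pist]] f0 hf; under eq_bigr do rewrite -pist mulr_suml.
rewrite exchange_big /=; apply: ler_sum => la _.
under eq_bigr do rewrite -mulrA.
rewrite -mulr_sumr ler_wpM2l//.
apply: le_trans (@trans_le la (fun m => \sum_(i < n) f i (m i)) _) _.
  by move=> m; rewrite sumr_ge0.
apply: le_pickE => k kla; apply: wsum_conf => //; exact: npart_sum.
Qed.

(** By linearity only the new pile needs the joint law of the picks; each old pile needs just its
    own binomial law. *)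
Lemma pickE_drift la (F : nat -> R) (f : 'I_n -> nat -> R) (a : R) (b : 'I_n -> R) :
  pickE la (fun k => F (\sum_(i < n) k i)%N) <= a ->
  (forall i, \sum_k pickw la i k * f i (val la i - k)%N <= b i) ->
  pickE la (fun k => F (\sum_(i < n) k i)%N + \sum_(i < n) f i (val la i - k i)%N)
  <= a + \sum_i b i.
Proof.
move=> Fa fb; rewrite /pickE prodED lerD// prodE_sum; apply: ler_sum => i _.
by rewrite (prodE_coord (pickw1 la) i (fun k : 'I_n.+1 => f i (val la i - k)%N)).
Qed.

Lemma le_pickw la i (f g : nat -> R) :
  (forall k, (k <= val la i)%N -> f k <= g k) ->
  \sum_k pickw la i k * f k <= \sum_k pickw la i k * g k.
Proof.
move=> fg; apply: ler_sum => k _; have [kc|ck] := leqP k (ncand q (val la i)).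
  by rewrite ler_wpM2l ?pickw_ge0// fg// (leq_trans kc)// ncand_leq.
by rewrite /pickw /binw bin_small// !mul0r.
Qed.

(** The tangent of the concave function ln at 1 + h. The bound is linear in k, so only the binomial
    mean will enter. *)
Lemma ln_subn (h k : nat) : (k <= h)%N ->
  ln (1 + (h - k)%N%:R) <= ln (1 + h%:R) + - (1 + h%:R)^-1 * k%:R :> R.
Proof.
move=> kh; have h1 : 0 < 1 + h%:R :> R by rewrite ltr_pwDl.
have k1 : 0 < 1 + (h - k)%N%:R :> R by rewrite ltr_pwDl.
rewrite -lerBlDl -ln_div ?posrE//.
rewrite (_ : _ / _ = 1 + - (1 + h%:R)^-1 * k%:R); last first.
  by rewrite natrB//; field; exact: lt0r_neq0.
apply: le_ln1Dx; rewrite mulNr ltrN2 mulrC ltr_pdivrMr// mul1r.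
by rewrite ltr_pwDl// ler_nat.
Qed.

Lemma npiles_bound (pi : {ffun npart n -> R}) : bs_stationary p q pi ->
  p * q * (\sum_la pi la * npiles la) <= 2 * ln (1 + n%:R).
Proof.
move=> st; have [pi0 [pi1 _]] := st.
pose g (h : nat) : R := ln (1 + h%:R).
have g0 h : 0 <= g h by rewrite ln_ge0// lerDl.
(* The weight does not depend on the index, so the exchange condition is an equality. *)
have := @stationary_le pi (fun=> g) st (fun=> g0) (fun _ x y _ => ltac:(by rewrite addrC)).
move/le_trans => /(_ (\sum_la pi la * (ln (1 + n%:R) +
   \sum_(i < n) (g (val la i) - p * q / 2 * (0 < val la i)%N%:R)))) h.
have {}h := h (ler_sum _ _).
have : \sum_la pi la * (\sum_(i < n) g (val la i)) <= \sum_la pi la * (ln (1 + n%:R) +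
   \sum_(i < n) (g (val la i) - p * q / 2 * (0 < val la i)%N%:R)).
  apply: h => la _; rewrite ler_wpM2l//.
  apply: (@pickE_drift _ g (fun=> g)) => [|i].
    rewrite -[leRHS](prodE_cst (pickw1 la)); apply: le_pickE => k kla.
    rewrite /g ler_ln ?posrE ?ltr_pwDl// lerD2l ler_nat -[leqRHS](npart_sum la).
    exact: leq_sum.
  apply: le_trans (le_pickw (g := fun k => _) (@ln_subn (val la i))) _.
  under eq_bigr do rewrite mulrDr mulrCA.
  rewrite big_split /= -mulr_suml -mulr_sumr pickw1 mul1r lerD2l.
  rewrite (sum_binw_mean p (ncand_npart la i)) mulNr lerN2.
  have [->|h0] := posnP (val la i : nat); first by rewrite mulr0 !mulr_ge0// invr_ge0 addr_ge0.
  (* The mean pick is at least p q h, and h / (1 + h) >= 1/2 for a nonempty pile: hence the loss p q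
     / 2. *)
  rewrite mulr1 [leRHS]mulrC ler_pdivlMr ?ltr_pwDl//.
  have cq := ncand_ge (val la i) q0.
  have h1 : 1 <= (val la i : nat)%:R :> R by rewrite ler1n.
  have := ler_wpM2l p0 cq; have := mulr_ge0 p0 q0; nra.
under [leRHS]eq_bigr => la _.
  rewrite sumrB -mulr_sumr -/(npiles la) addrA mulrBr mulrDr [X in _ - X]mulrCA.
  over.
rewrite sumrB big_split /= -mulr_suml pi1 mul1r -mulr_sumr; lra.
Qed.

Lemma sum_ncand la :
  n%:R * q <= \sum_(i < n) (ncand q (val la i))%:R <= n%:R * q + npiles la.
Proof.
have -> : n%:R * q = \sum_(i < n) q * (val la i : nat)%:R.
  by rewrite -mulr_sumr -natr_sum npart_sum mulrC.
apply/andP; split; first by apply: ler_sum => i _; exact: ncand_ge.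
by rewrite -big_split; apply: ler_sum => i _; exact: ncand_le.
Qed.

(** * Drift of the smoothed distance to the geometric profile *)

Variables (W : R).
Hypothesis W1 : 1 <= W.
Let W0 : 0 < W. Proof. exact: lt_le_trans W1. Qed.

(* A second-order expansion around the mean: the linear term averages out, so
   one move only costs the variance divided by the scale [W]. *)
Lemma pile_drift la i a :
  \sum_k pickw la i k * soft W ((val la i - k)%N%:R - a) <=
  soft W ((val la i : nat)%:R - p * (ncand q (val la i))%:R - a)
  + (2 * W)^-1 * (p * (ncand q (val la i))%:R).
Proof.
set h := (val la i : nat); set c := (ncand q h)%:R.
set u := h%:R - p * c - a.
pose g k := soft W u + (u / hyp W u * (p * c) +
   (- (u / hyp W u) * k%:R + (2 * W)^-1 * (p * c - k%:R) ^+ 2)).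
apply: (@le_trans _ _ (\sum_k pickw la i k * g k)).
  apply: (@le_pickw la i (fun k => soft W ((h - k)%N%:R - a))) => k kh.
  rewrite /g; have := soft_taylor W0 u (p * c - k%:R).
  have -> : (h - k)%N%:R - a = u + (p * c - k%:R) by rewrite natrB// /u; ring.
  lra.
under eq_bigr do rewrite /g !mulrDr [X in _ + (_ + (X + _))]mulrCA
   [X in _ + (_ + (_ + X))]mulrCA.
rewrite !big_split /= -!mulr_suml -!mulr_sumr pickw1.
rewrite (sum_binw_mean p (ncand_npart la i)).
rewrite (sum_binw_variance p (ncand_npart la i)) -/h -/c.
have : (2 * W)^-1 * (p * (1 - p) * c) <= (2 * W)^-1 * (p * c).
  rewrite ler_wpM2l ?invr_ge0 ?mulr_ge0 ?(ltW W0)//.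
  by rewrite ler_wpM2r// ler_piMr// gerBl.
rewrite /soft; lra.
Qed.

(** The same expansion for a sum of independent binomials, whose variances add up. *)
Lemma new_pile_drift la a :
  pickE la (fun k => soft W ((\sum_(i < n) k i)%N%:R - a)) <=
  soft W (p * (\sum_(i < n) (ncand q (val la i))%:R) - a)
  + (2 * W)^-1 * (p * (\sum_(i < n) (ncand q (val la i))%:R)).
Proof.
set c := \sum_(i < n) (ncand q (val la i))%:R; set u := p * c - a.
pose X i (k : 'I_n.+1) : R := p * (ncand q (val la i))%:R - k%:R.
have X0 i : \sum_k pickw la i k * X i k = 0.
  under eq_bigr do rewrite mulrBr.
  rewrite sumrB -mulr_suml pickw1 (sum_binw_mean p (ncand_npart la i)).
  by rewrite mul1r subrr.
apply: (@le_trans _ _ (pickE la (fun k => soft W u + (- (u / hyp W u) *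
   (\sum_i X i (k i)) + (2 * W)^-1 * (\sum_i X i (k i)) ^+ 2)))).
  apply: le_pickE => k _; have := soft_taylor W0 u (- \sum_i X i (k i)).
  rewrite sqrrN; have -> : (\sum_i k i)%N%:R - a = u - \sum_i X i (k i).
    by rewrite sumrB -mulr_sumr -/c natr_sum /u; ring.
  lra.
rewrite /pickE prodED (prodE_cst (pickw1 la)) prodED !prodEZ prodE_sum.
rewrite big1 => [|i _]; last by rewrite (prodE_coord (pickw1 la)) X0.
rewrite (prodE_variance (pickw1 la) X0) mulr0 add0r lerD2l.
rewrite ler_wpM2l ?invr_ge0 ?mulr_ge0 ?(ltW W0)//.
rewrite mulr_sumr; apply: ler_sum => i _.
by rewrite (sum_binw_variance p (ncand_npart la i)) ler_wpM2r// ler_piMr// gerBl.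
Qed.

Let s := p * q.
Definition ideal (i : nat) : R := s * n%:R * (1 - s) ^+ i.

Lemma s_ge0 : 0 <= s. Proof. exact: mulr_ge0. Qed.
Lemma s_le1 : s <= 1. Proof. by rewrite mulr_ile1. Qed.

Lemma ideal_noninc i : ideal i.+1 <= ideal i.
Proof.
rewrite /ideal ler_wpM2l ?mulr_ge0 ?s_ge0// exprS ler_piMl ?exprn_ge0//.
  by rewrite subr_ge0 s_le1.
by have := s_ge0; lra.
Qed.

Definition dist la : R := \sum_(i < n) soft W ((val la i : nat)%:R - ideal i).

Lemma dist_bound (pi : {ffun npart n -> R}) : bs_stationary p q pi ->
  s * (\sum_la pi la * dist la) <=
  3 * p * (\sum_la pi la * npiles la) + s * n%:R / W.
Proof.
move=> st; have [pi0 [pi1 _]] := st.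
have dr la : pickE la (fun k => soft W ((\sum_(i < n) k i)%N%:R - ideal 0)
    + \sum_(i < n) soft W ((val la i - k i)%N%:R - ideal i.+1)) <=
    (1 - s) * dist la + 3 * p * npiles la + s * n%:R / W.
  apply: le_trans (@pickE_drift la (fun h => soft W (h%:R - ideal 0))
    (fun i h => soft W (h%:R - ideal i.+1)) _ _ (new_pile_drift la _)
    (fun i => pile_drift la i _)) _.
  have V0 : 0 <= (2 * W)^-1 by rewrite invr_ge0 mulr_ge0 ?(ltW W0).
  have /andP[S1 S2] := sum_ncand la.
  set S := \sum_(i < n) (ncand q (val la i))%:R in S1 S2 *.
  have first : soft W (p * S - ideal 0) <= p * npiles la.
    have -> : p * S - ideal 0 = 0 + (p * S - ideal 0) by rewrite add0r.
    apply: le_trans (soft_lip _ _ _) _; rewrite soft0// add0r.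
    have pS1 := ler_wpM2l p0 S1; have pS2 := ler_wpM2l p0 S2.
    rewrite /ideal expr0 mulr1 /s ger0_norm; lra.
  have other i : soft W ((val la i : nat)%:R - p * (ncand q (val la i))%:R - ideal i.+1)
      <= (1 - s) * soft W ((val la i : nat)%:R - ideal i) + p * (0 < val la i)%N%:R.
    set h := (val la i : nat).
    have c1 := ler_wpM2l p0 (ncand_ge h q0).
    have c2 := ler_wpM2l p0 (ncand_le h q0).
    (* The profile satisfies c_(i+1) = (1-s) c_i, so the deviation shrinks by 1-s up to the rounding
       error. *)
    have -> : h%:R - p * (ncand q h)%:R - ideal i.+1 =
        (1 - s) * (h%:R - ideal i) + - (p * (ncand q h)%:R - s * h%:R).
      by rewrite /ideal exprS /s; ring.
    apply: le_trans (soft_lip _ _ _) _.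
    apply: lerD; first exact: soft_contract W0 _ _ s_ge0 s_le1.
    rewrite normrN ger0_norm /s; lra.
  have := ler_sum (index_enum 'I_n) (P := xpredT) (fun i _ => other i).
  rewrite !big_split /= -!mulr_sumr -/(dist la) -/(npiles la) -/S.
  (* This bounds the noise of the new pile and also that of all old piles together, so the two
     halves add one p times [npiles] to the two from rounding: the constant 3. Here W >= 1 absorbs a
     division by W. *)
  have VS : (2 * W)^-1 * (p * S) <= (s * n%:R / W + p * npiles la) / 2.
    have -> : (2 * W)^-1 * (p * S) = (p * S / W) / 2 by field; exact: lt0r_neq0.
    rewrite ler_pM2r ?invr_gt0// ler_pdivrMr// mulrDl divfK ?lt0r_neq0//.
    have pS2 := ler_wpM2l p0 S2.
    have : p * npiles la <= p * npiles la * W.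
      by rewrite ler_peMr// mulr_ge0// sumr_ge0.
    rewrite /s; lra.
  lra.
have := @stationary_le pi (fun i h => soft W (h%:R - ideal i)) st.
move=> /(_ (fun _ _ => soft_ge0 _ _)) h.
have : \sum_la pi la * dist la <= \sum_la pi la *
    ((1 - s) * dist la + 3 * p * npiles la + s * n%:R / W).
  apply: le_trans (h _) _ => [i x y xy|].
    by apply: soft_exchange; rewrite ?ler_nat ?ideal_noninc.
  by apply: ler_sum => la _; rewrite ler_wpM2l.
under [leRHS]eq_bigr do rewrite !mulrDr mulrCA [X in _ + X + _]mulrCA.
rewrite !big_split /= -!mulr_sumr -mulr_suml pi1; lra.
Qed.

End Dynamics.

(** * Deviations from the exponential profile *)

Lemma part_at_ord n (la : npart n) (i : 'I_n) : part_at la i = val la i.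
Proof. by rewrite /part_at valK. Qed.

Lemma part_at_noninc n (la : npart n) j k : (j <= k)%N ->
  (part_at la k <= part_at la j)%N.
Proof.
move=> jk; have [kn|nk] := ltnP k n; last first.
  by rewrite {1}/part_at insubF// ltnNge nk.
have jn := leq_ltn_trans jk kn.
by rewrite (part_at_ord la (Ordinal kn)) (part_at_ord la (Ordinal jn)) npart_noninc.
Qed.

Section Deviation.
Variable R : realType.

(** Here 1-s lies between exp(-s/(1-s)) and exp(-s), and s times the truncated index lies between
    x-s and x; s <= 1/2 gives 1/(1-s) <= 1+2s. *)
Lemma expr_truncn_approx (s x : R) : 0 < s -> s <= 2^-1 -> 0 <= x ->
  `|(1 - s) ^+ Num.truncn (s^-1 * x) - expR (- x)| <= 2 * s * (1 + x).
Proof.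
move=> s0 s2 x0; set m := Num.truncn _.
have sx0 : 0 <= s^-1 * x by rewrite mulr_ge0// invr_ge0 ltW.
have m1 : s * m%:R <= x by rewrite -ler_pdivlMl// truncn_le.
have m2 : x - s <= s * m%:R.
  have := ltW (truncnS_gt (s^-1 * x)); rewrite -/m ler_pdivrMl// -natr1; lra.
have e1 : expR (- x) <= 1 by rewrite -expR0 ler_expR; lra.
have e0 := expR_gt0 (- x).
have s1 : 0 < 1 - s by lra.
have sE : expR s <= (1 - s)^-1.
  have := expR_ge1Dx (- s); rewrite expRN => h.
  by rewrite -[leLHS]invrK lef_pV2 ?posrE// invr_gt0 expR_gt0.
have up : (1 - s) ^+ m <= expR (- x) * (1 - s)^-1.
  apply: (@le_trans _ _ (expR (- s) ^+ m)).
    by rewrite lerXn2r ?nnegrE ?expR_ge0 ?(ltW s1)// expR_ge1Dx.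
  rewrite -expRM_natr; apply: (@le_trans _ _ (expR (- x + s))).
    by rewrite ler_expR; lra.
  by rewrite expRD ler_pM2l.
have i2 : (1 - s)^-1 <= 1 + 2 * s by rewrite -[leLHS]mul1r ler_pdivrMr//; nra.
have lo : expR (- x) * (1 - 2 * s * x) <= (1 - s) ^+ m.
  have base : expR (- (1 - s)^-1 * s) <= 1 - s.
    rewrite mulNr expRN -[leRHS]invrK lef_pV2 ?posrE ?expR_gt0 ?invr_gt0//.
    apply: le_trans (expR_ge1Dx _).
    by rewrite [leRHS](_ : _ = (1 - s)^-1)//; field; exact: lt0r_neq0.
  apply: (@le_trans _ _ (expR (- (1 - s)^-1 * s) ^+ m)); last first.
    by rewrite lerXn2r ?nnegrE ?expR_ge0 ?(ltW s1).
  rewrite -expRM_natr; apply: (@le_trans _ _ (expR (- x + - (2 * s * x)))).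
    by rewrite expRD ler_pM2l// expR_ge1Dx.
  have i0 : 0 <= (1 - s)^-1 by rewrite invr_ge0 ltW.
  have := ler_wpM2l i0 m1; have := ler_wpM2r x0 i2.
  rewrite ler_expR; lra.
have sx : 0 <= s * x by rewrite mulr_ge0// ltW.
have up2 : expR (- x) * (1 - s)^-1 <= expR (- x) * (1 + 2 * s) by rewrite ler_pM2l.
rewrite ler_norml; apply/andP; split; nra.
Qed.

Variables (n : nat) (p q : R).
Implicit Type la : npart n.
Hypotheses (p0 : 0 < p) (p1 : p <= 1) (q0 : 0 < q) (q1 : q <= 1).
Let s := p * q.
Let W := s * n%:R.
Let s0 : 0 < s. Proof. exact: mulr_gt0. Qed.
Let s1 : s <= 1. Proof. by rewrite mulr_ile1// ltW. Qed.
Let W0 : 0 <= W. Proof. by rewrite mulr_ge0// ltW. Qed.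

Lemma ideal_le j k : (j <= k)%N -> ideal n p q k <= ideal n p q j.
Proof.
by apply: (@homo_leq _ (ideal n p q) (fun x y => y <= x)) => //=;
  [move=> a b c ab bc; exact: le_trans bc ab |move=> i; exact: ideal_noninc (ltW _) _ (ltW _) _ _].
Qed.

(** Consecutive values differ by s c_j, which is at most s c_0 = s W. *)
Lemma ideal_lip j m : ideal n p q j <= ideal n p q (j + m) + m%:R * s * W.
Proof.
elim: m => [|m IH]; first by rewrite addn0 !mul0r addr0.
apply: le_trans IH _; rewrite -natr1 addnS.
have := ideal_le (leq0n (j + m)); rewrite /ideal -/s exprS expr0 -/W => h.
have := ler_wpM2l (ltW s0) h; lra.
Qed.

Lemma dist_ge la a d K : (a + d < n)%N -> 0 <= K ->
  (forall j, (a <= j <= a + d)%N -> K <= soft W ((part_at la j)%:R - ideal n p q j)) ->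
  d.+1%:R * K <= dist p q W la.
Proof.
move=> adn K0 h.
have -> : dist p q W la =
    \sum_(0 <= j < n) soft W ((part_at la j)%:R - ideal n p q j).
  by rewrite big_mkord; apply: eq_bigr => i _; rewrite part_at_ord.
rewrite (big_cat_nat (n := a))//=; last by lia.
rewrite (big_cat_nat (m := a) (n := (a + d).+1))//=; last by lia.
apply: (@le_trans _ _ (\sum_(a <= j < (a + d).+1) K)).
  by rewrite sumr_const_nat -addnS addKn mulr_natl.
rewrite -[leLHS]add0r lerD ?sumr_ge0// => [j _|]; first exact: soft_ge0.
rewrite -[leLHS]addr0 lerD ?sumr_ge0// => [|j _]; last exact: soft_ge0.
by apply: ler_sum_nat => j aj; apply: h; lia.
Qed.

(* Both profiles are nonincreasing and the ideal one is Lipschitz, so a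
   deviation at one index persists on one side over [d + 1] indices. *)
Lemma deviation_dist la i d delta : 0 <= delta ->
  (d <= i)%N -> (i + d < n)%N -> d%:R * s <= delta ->
  3 * delta * W <= `|(part_at la i)%:R - ideal n p q i| ->
  d.+1%:R * soft W (2 * delta * W) <= dist p q W la.
Proof.
move=> delta0 di idn ds dev.
have dW0 : 0 <= 2 * delta * W by rewrite mulr_ge0// mulr_ge0.
have lip j m : (m <= d)%N -> ideal n p q j <= ideal n p q (j + m) + delta * W.
  move=> md; apply: le_trans (ideal_lip j m) _; rewrite lerD2l ler_wpM2r//.
  by apply: le_trans ds; rewrite ler_pM2r// ler_nat.
(* An excess persists to the left of i, a deficit to the right. Within d steps the profile changes
   by at most delta W, so 2 delta W of the 3 delta W survive. *)
have [h|h] := leP 0 ((part_at la i)%:R - ideal n p q i).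
- move: dev; rewrite (ger0_norm h) => dev.
  apply: (@dist_ge _ (i - d)); rewrite ?soft_ge0//; first by lia.
  move=> j jd; apply: soft_mono => //; apply: le_trans (ler_norm _).
  have l1 := lip j (i - j)%N ltac:(lia).
  have ji : (j + (i - j) = i)%N by lia.
  rewrite ji in l1.
  have : (part_at la i)%:R <= (part_at la j)%:R :> R.
    by rewrite ler_nat part_at_noninc//; lia.
  lra.
- move: dev; rewrite (ltr0_norm h) => dev.
  apply: (@dist_ge _ i); rewrite ?soft_ge0// => j jd.
  apply: soft_mono => //; rewrite -normrN; apply: le_trans (ler_norm _).
  have l1 := lip i (j - i)%N ltac:(lia).
  have ji : (i + (j - i) = j)%N by lia.
  rewrite ji in l1.
  have : (part_at la j)%:R <= (part_at la i)%:R :> R.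
    by rewrite ler_nat part_at_noninc//; lia.
  lra.
Qed.

Lemma mean_dist_bound (pi : {ffun npart n -> R}) : bs_stationary p q pi ->
  1 <= W ->
  s * (\sum_la pi la * dist p q W la) <= 6 * ln (1 + n%:R) / q + 1.
Proof.
move=> st W1.
have h1 := npiles_bound (ltW p0) p1 (ltW q0) q1 st.
have h2 := dist_bound (ltW p0) p1 (ltW q0) q1 W1 st.
apply: le_trans h2 _; rewrite -/s -/W divff; last by apply: lt0r_neq0; exact: lt_le_trans W1.
by rewrite lerD2r ler_pdivlMr//; lra.
Qed.

(** Markov's inequality for [dist]. Of the deviation 4 delta, one delta pays for replacing the
    exponential by the geometric profile and three remain for [deviation_dist]. *)
Lemma deviation_prob (pi : {ffun npart n -> R}) x delta :
  bs_stationary p q pi -> 0 < x -> 0 < delta -> 1 <= W -> x + delta < W ->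
  `|(1 - s) ^+ Num.truncn (s^-1 * x) - expR (- x)| <= delta ->
  Num.min x delta * (Num.sqrt ((2 * delta) ^+ 2 + 1) - 1) *
  (\sum_(la | 4 * delta <= `|rho s^-1 la x - expR (- x)|) pi la) <=
  6 * ln (1 + n%:R) / (p * q ^+ 2 * n%:R) + W^-1.
Proof.
move=> st x0 delta0 W1 xW approx; have [pi0 _] := st.
set beta := Num.min x delta; set kappa := _ - 1; set S := \sum_(la | _) _.
have beta0 : 0 < beta by rewrite lt_min x0.
(* The window has about beta / s indices: beta <= x keeps it from passing index 0, beta <= delta
   keeps the profile nearly constant on it. *)
have [bx bd] : beta <= x /\ beta <= delta by rewrite !ge_min !lexx orbT.
have Wp : 0 < W by lra.
have n0 : 0 < n%:R :> R by rewrite -(pmulr_rgt0 _ s0).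
set i := Num.truncn (s^-1 * x) in approx.
pose d := Num.truncn (s^-1 * beta).
have isx : s * i%:R <= x.
  by rewrite -ler_pdivlMl// truncn_le mulr_ge0 ?invr_ge0 ?ltW.
have dsx : s * d%:R <= beta.
  by rewrite -ler_pdivlMl// truncn_le mulr_ge0 ?invr_ge0 ?ltW.
have dlt : beta <= s * d.+1%:R by rewrite -ler_pdivrMl// ltW// truncnS_gt.
have di : (d <= i)%N by rewrite le_truncn// ler_pM2l ?invr_gt0.
(* As s n = W, the hypothesis x + delta < W keeps the window below index n. *)
have idn : (i + d < n)%N.
  rewrite -(ltr_nat R) -(ltr_pM2l s0) natrD mulrDr -/W; lra.
have kappaW : 0 <= kappa * W by rewrite /kappa -soft_scale// soft_ge0.
have step : S * (d.+1%:R * (kappa * W)) <= \sum_la pi la * dist p q W la.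
  rewrite mulr_suml big_mkcond /=; apply: ler_sum => la _; case: ifPn => [dev|_].
    rewrite ler_wpM2l// /kappa -soft_scale//.
    apply: (@deviation_dist _ i) => //; rewrite ?(ltW delta0)//.
      by rewrite mulrC; lra.
    have rE : rho s^-1 la x = (part_at la i)%:R / W.
      by rewrite /rho /W -/i [(s * n%:R)^-1]invfM; ring.
    have iE : ideal n p q i = (1 - s) ^+ i * W by rewrite /ideal mulrC.
    have -> : (part_at la i)%:R - ideal n p q i =
        ((part_at la i)%:R / W - (1 - s) ^+ i) * W.
      by rewrite iE mulrBl divfK// lt0r_neq0.
    rewrite normrM (gtr0_norm Wp) ler_pM2r//; move: dev; rewrite rE.
    have := ler_distD ((1 - s) ^+ i) ((part_at la i)%:R / W) (expR (- x)); lra.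
  by rewrite mulr_ge0// sumr_ge0// => j _; exact: soft_ge0.
have S0 : 0 <= S by exact: sumr_ge0.
have mean := mean_dist_bound st W1.
have main : S * beta * (kappa * W) <= 6 * ln (1 + n%:R) / q + 1.
  apply: le_trans mean; apply: le_trans (ler_wpM2l (ltW s0) step).
  rewrite -mulrA [leRHS](_ : _ = S * (s * d.+1%:R * (kappa * W))); last by ring.
  by rewrite !ler_wpM2l// ler_wpM2r.
rewrite -(ler_pM2r Wp) mulrDl mulVf ?lt0r_neq0//.
rewrite [leLHS](_ : _ = S * beta * (kappa * W)); last by ring.
apply: le_trans main _; rewrite lerD2r /W /s.
rewrite le_eqVlt; apply/orP; left; apply/eqP; field.
by rewrite !lt0r_neq0.
Qed.

End Deviation.

(** * Passage to the limit *)

Theorem theorem3 (R : realType) (p q : nat -> R)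
  (hp : forall n, 0 < p n <= 1) (hq : forall n, 0 < q n <= 1)
  (hpq : (fun n => p n * q n) @ \oo --> 0)
  (hlog : (fun n => p n * q n ^+ 2 * n%:R / ln (n%:R : R)) @ \oo --> +oo)
  (pi : forall n, {ffun npart n -> R})
  (hpi : forall n, (0 < n)%N -> bs_stationary (p n) (q n) (pi n)) :
  forall x eps : R, 0 < x -> 0 < eps ->
    (fun n : nat => \sum_(la : npart n
                   | `| rho (p n * q n)^-1 la x - expR (- x) | < eps) pi n la)
      @ \oo --> (1 : R^o).
Proof.
move=> x eps x0 eps0; set delta := eps / 4.
have delta0 : 0 < delta by rewrite divr_gt0.
set c := Num.min x delta * (Num.sqrt ((2 * delta) ^+ 2 + 1) - 1).
have c0 : 0 < c.
  rewrite mulr_gt0 ?lt_min ?x0// subr_gt0 -[ltLHS]sqrtr1 ltr_sqrt.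
    by rewrite ltrDr exprn_gt0// mulr_gt0.
  by rewrite ltr_wpDl// sqr_ge0.
have l20 : 0 < ln 2 :> R by rewrite ln_gt0// ltr1n.
(* With u the quantity in [hlog], the error terms are at most 12 / u, by 1 + n <= n^2, and 1 / (u ln
   2), by W >= u ln 2. *)
set C := 12 + (ln 2)^-1 : R.
have C0 : 0 < C by rewrite ltr_wpDr// invr_ge0 ltW.
apply/cvgrPdist_lt => e e0.
have /cvgryPgt hlog' := hlog.
have /cvgr0Pnorm_lt hpq' := hpq.
near=> n.
have n2 : (2 <= n)%N by near: n; exact: nbhs_infty_ge.
have [pn0 pn1] := andP (hp n); have [qn0 qn1] := andP (hq n).
have s0 : 0 < p n * q n by exact: mulr_gt0.
have st := hpi n (leq_trans (leqnSn 1) n2).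
have uC : C / (c * e) < p n * q n ^+ 2 * n%:R / ln n%:R by near: n; exact: hlog'.
(* This threshold yields W > x + delta + 1, hence both conditions on W in [deviation_prob]. *)
have uW : (x + delta + 1) / ln 2 < p n * q n ^+ 2 * n%:R / ln n%:R.
  by near: n; exact: hlog'.
have smallx : `|p n * q n| < delta / (2 * (1 + x)).
  by near: n; apply: hpq'; rewrite divr_gt0// mulr_gt0// addr_gt0.
have small2 : `|p n * q n| < 2^-1 by near: n; apply: hpq'; rewrite invr_gt0.
set u := p n * q n ^+ 2 * n%:R / ln n%:R in uC uW.
rewrite (gtr0_norm s0) in smallx small2.
have n0 : 0 < n%:R :> R by rewrite ltr0n; exact: leq_trans n2.
have l2n : ln 2 <= ln (n%:R) :> R by rewrite ler_ln ?posrE// ler_nat.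
have ln0 : 0 < ln (n%:R) :> R by exact: lt_le_trans l2n.
have u0 : 0 < u by apply: lt_trans uC; rewrite divr_gt0// mulr_gt0.
have uE : u * ln (n%:R) = p n * q n ^+ 2 * n%:R by rewrite divfK ?lt0r_neq0.
have uleW : u * ln 2 <= p n * q n * n%:R.
  apply: (@le_trans _ _ (u * ln (n%:R))); first by rewrite ler_pM2l.
  by rewrite uE ler_pM2r// expr2 mulrA ler_piMr// ltW.
have xW : x + delta + 1 < p n * q n * n%:R.
  by apply: lt_le_trans uleW; rewrite -ltr_pdivrMr.
have approx : `|(1 - p n * q n) ^+ Num.truncn ((p n * q n)^-1 * x) - expR (- x)| <= delta.
  apply: le_trans (expr_truncn_approx s0 (ltW small2) (ltW x0)) _.
  have x1 : 0 < 2 * (1 + x) by rewrite mulr_gt0// addr_gt0.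
  by move: smallx; rewrite ltr_pdivlMr// => /ltW; rewrite mulrCA mulrA.
have := deviation_prob pn0 pn1 qn0 qn1 st x0 delta0 _ _ approx.
move=> /(_ ltac:(lra) ltac:(lra)); rewrite -/c.
have -> : 4 * delta = eps by rewrite /delta; field.
set S := \sum_(la | _) _ => Sle.
have -> : \sum_(la | `|rho (p n * q n)^-1 la x - expR (- x)| < eps) pi n la = 1 - S.
  have [_ [<- _]] := st.
  rewrite [X in X - _](bigID (fun la => `|rho (p n * q n)^-1 la x - expR (- x)| < eps))/=.
  rewrite (_ : S = \sum_(la | ~~ (`|rho (p n * q n)^-1 la x - expR (- x)| < eps))
      pi n la) ?addrK//.
  by apply: eq_bigl => la; rewrite leNgt.
have S0 : 0 <= S by apply: sumr_ge0 => la _; have [+ _] := st; apply.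
rewrite opprB addrC subrK ger0_norm//.
have ln2 : ln (1 + n%:R) <= 2 * ln (n%:R) :> R.
  rewrite -ln_powR powR_mulrn ?ler0n// ler_ln ?posrE ?exprn_gt0 ?addr_gt0//.
  by have : 2 <= n%:R :> R; [rewrite ler_nat | nra].
have Su : c * S <= C / u.
  apply: le_trans Sle _; rewrite /C [leRHS]mulrDl; apply: lerD.
    rewrite -uE (ler_pdivrMr _ _ (mulr_gt0 u0 ln0)) [leRHS](_ : _ = 12 * ln (n%:R)); last first.
      by field; rewrite lt0r_neq0.
    lra.
  by rewrite -invfM lef_pV2 ?posrE ?(mulr_gt0 l20 u0) ?(mulr_gt0 s0 n0)// mulrC.
rewrite -(ltr_pM2l c0); apply: le_lt_trans Su _.
by rewrite ltr_pdivrMr// mulrC -ltr_pdivrMr// mulr_gt0.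
Unshelve. all: by end_near.
Qed.
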